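(* Let $G=(V=[n],E=[m])$ be an undirected graph with vertex-edge incidence matrix $A\in\{0,1\}^{n\times m}$, with edge weights $c\in\mathbb{R}^m$, $c_i>0$ for all $i$, and $d\in\mathbb{R}^m$, $d_i\ge 0$ for all $i$, and let $d_0>0$. Consider the ratio matching game $$\nu(w)=\max_{x\in\{0,1\}^m}\left[\frac{c^Tx}{d_0+d^Tx}:\ Ax\le w\right],\qquad w\in\{0,1\}^n.$$ Let $G'$ be the graph obtained from $G$ by deleting all edges $e$ with $d_e>0$ and giving each remaining edge $e$ the weight $c_e/d_0$. Then $\nu$ has a non-empty core if and only if $$\max_{x\in\mathbb{R}^m_+}\left[\sum_{i=1}^m\frac{c_i}{d_0+d_i}x_i:\ Ax\le\mathbf{1}_n\right]$$ equals the larger of $\max_{i\in[m]}\frac{c_i}{d_0+d_i}$ and the weight of a maximum weight matching of $G'$.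
   Context: Notation: $[n]=\{1,\dots,n\}$; $\mathbf{1}_n$ is the all-one vector; $\mathbb{R}^m_+$ is the set of componentwise non-negative vectors; $A_{ij}=1$ if vertex $i$ is incident with edge $j$, and $0$ otherwise; vector inequalities are componentwise. Players are the vertices. The empty matching has weight $0$. The core of a (revenue) game $\nu:\{0,1\}^n\to\mathbb{R}$ is $\mathrm{core}(\nu)=\{y\in\mathbb{R}^n:\mathbf{1}_n^Ty=\nu(\mathbf{1}_n),\ a^Ty\ge\nu(a)\ \forall a\in\{0,1\}^n\}$. *)

(* Defs.v *)
From HB Require Import structures.
From mathcomp Require Import all_boot all_order all_algebra.
From mathcomp Require Import classical_sets reals.

Set Implicit Arguments.
Unset Strict Implicit.
Unset Printing Implicit Defensive.

Import Order.TTheory GRing.Theory Num.Theory.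
Local Open Scope ring_scope.

(* Undirected graph on the vertex type V with edge labels E: every edge has
   exactly two endpoints, so there are no loops.  Distinct labels may have the
   same endpoints; simple graphs are the case where [ends] is injective. *)
Record graph (V E : finType) := Graph {
  ends : E -> {set V};
  card_ends : forall e, #|ends e| = 2
}.

Definition matching (V E : finType) (G : graph V E) (M : {set E}) : bool :=
  [forall e in M, forall f in M,
     (e != f) ==> [disjoint ends G e & ends G f]].

(* The default 0 is the weight of the empty matching, which is always among
   the candidates. *)
Definition max_matching_weight (R : realType) (V E : finType) (G : graph V E)
    (wt : E -> R) : R :=
  \big[Num.max/0]_(M : {set E} | matching G M) \sum_(e in M) wt e.

Definition keep_edges (V E : finType) (G : graph V E) (P : pred E) :
    graph V {e : E | P e} :=
  @Graph V {e : E | P e} (fun e => ends G (val e))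
    (fun e => card_ends G (val e)).

Definition incidence (R : realType) (n m : nat) (G : graph 'I_n 'I_m) :
    'M[R]_(n, m) :=
  \matrix_(i < n, j < m) (i \in ends G j)%:R.

(* Vectors of {0,1}^k are boolean columns; [realv] reads them in R^k. *)
Definition realv (R : realType) (k : nat) (b : 'cV[bool]_k) : 'cV[R]_k :=
  map_mx (fun t : bool => t%:R) b.

Definition dot (R : realType) (k : nat) (u v : 'cV[R]_k) : R :=
  \sum_(i < k) u i 0 * v i 0.

(* Componentwise order. *)
Definition lev (R : realType) (k : nat) (u v : 'cV[R]_k) : bool :=
  [forall i, u i 0 <= v i 0].

Definition game (R : realType) (n : nat) := 'cV[bool]_n -> R.

Definition core (R : realType) (n : nat) (nu : game R n) : set 'cV[R]_n :=
  [set y | dot (const_mx 1) y = nu (const_mx true) /\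
           forall a : 'cV[bool]_n, nu a <= dot (realv R a) y]%classic.

(* The default 0 does not change the maximum: x = 0 is feasible for every w
   and has value 0. *)
Definition ratio_matching_game (R : realType) (n m : nat)
    (G : graph 'I_n 'I_m) (c d : 'cV[R]_m) (d0 : R) : game R n :=
  fun w => \big[Num.max/0]_(x : 'cV[bool]_m |
      lev (incidence R G *m realv R x) (realv R w))
    (dot c (realv R x) / (d0 + dot d (realv R x))).

Definition edge_ratio (R : realType) (m : nat) (c d : 'cV[R]_m) (d0 : R) :
    'cV[R]_m :=
  \col_(i < m) (c i 0 / (d0 + d i 0)).

(* For positive c the ratios are positive, so the default 0 is only the value
   for an edgeless graph. *)
Definition max_edge_ratio (R : realType) (m : nat) (c d : 'cV[R]_m) (d0 : R) :
    R :=
  \big[Num.max/0]_(i < m) edge_ratio c d d0 i 0.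

(* Maximum weight of a matching once the edges e with d_e > 0 are deleted and
   every remaining edge e is given the weight c_e / d0. *)
Definition max_matching_weight_reduced (R : realType) (n m : nat)
    (G : graph 'I_n 'I_m) (c d : 'cV[R]_m) (d0 : R) : R :=
  max_matching_weight (keep_edges G (fun e => ~~ (0 < d e 0)))
    (fun e => c (val e) 0 / d0).

Definition fractional_matching (R : realType) (n m : nat)
    (G : graph 'I_n 'I_m) : set 'cV[R]_m :=
  [set x | lev 0 x /\ lev (incidence R G *m x) (const_mx 1)]%classic.

(* v is the (attained) maximum of the objective f over X. *)
Definition is_max (R : realType) (T : Type) (X : set T) (f : T -> R) (v : R) :
    Prop :=
  (exists2 x, X x & f x = v) /\ (forall x, X x -> f x <= v).

(* Main.v *)
Require Import Defs.
From HB Require Import structures.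
From mathcomp Require Import all_boot all_order all_algebra.
From mathcomp Require Import classical_sets reals.

Set Implicit Arguments.
Unset Strict Implicit.
Unset Printing Implicit Defensive.

Import Order.TTheory GRing.Theory Num.Theory.
Local Open Scope ring_scope.

(** Write r_e = c_e / (d_0 + d_e), and call y a fractional vertex cover for r
    if y >= 0 and the values of y at the two ends of every edge e add up to at
    least r_e.

    A vector y lies in the core exactly when y is a fractional vertex cover
    for r of total value nu(1) ([core_fractional_vertex_cover]).  Necessity is
    seen on the coalitions {i} and on the pairs of ends of edges.  For
    sufficiency, a matching M has ratio at most the sum of r_e over M
    ([matching_ratio_le_dot]), since each denominator d_0 + d(M) is at least
    d_0 + d_e, and this sum is at most the value of y on any coalition that
    contains the ends of M.  Fractional vertex covers for r are the feasible
    solutions of the dual of the fractional matching problem, so by linear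
    programming duality ([cover_weak_duality], [cover_strong_duality]) the
    core is non-empty if and only if the fractional maximum equals nu(1).

    It remains to compare nu(1) with v, the larger of max_e r_e and the
    maximum weight of a matching of G'.  Single edges and matchings of G' show
    v <= nu(1) ([candidates_le_game]).  In general v can be smaller, but if
    nu(1) equals the fractional maximum, then a matching M optimal for nu(1)
    makes all the inequalities above tight: d_e = d(M) for every e in M, so
    d(M) = |M| d(M).  Hence either M is a single edge, or d vanishes on M and
    M is a matching of G'; so nu(1) <= v ([tight_ratio_le_candidates]).

    Strong duality is derived from Farkas' lemma ([farkas]), which is proved
    by Fourier-Motzkin elimination. *)

(** * Farkas' lemma *)

Lemma sum_pred1_mul (R : pzRingType) (I : finType) (j : I) (f : I -> R) :
  \sum_l (l == j)%:R * f l = f j.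
Proof.
rewrite (bigD1 j) //= eqxx mul1r big1 ?addr0 // => l /negPf ->.
by rewrite mul0r.
Qed.

Lemma between_finite (R : realDomainType) (I : finType) (P Q : pred I)
    (lo hi : I -> R) :
  (forall i j, P i -> Q j -> lo i <= hi j) ->
  exists z, (forall i, P i -> lo i <= z) /\ (forall j, Q j -> z <= hi j).
Proof.
move=> lohi; case: (pickP P) => [i0 Pi0|P0].
  case: (arg_maxP lo Pi0) => i Pi ub_i.
  by exists (lo i); split=> [k /ub_i //|j Qj]; apply: lohi.
case: (pickP Q) => [j0 Qj0|Q0].
  case: (arg_minP hi Qj0) => j Qj lb_j.
  by exists (hi j); split=> [k|k /lb_j //]; rewrite P0.
by exists 0; split=> k; rewrite ?P0 ?Q0.
Qed.

(** A finite system of linear inequalities either has a solution or has a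
    nonnegative combination that reads 0 <= negative.  The proof eliminates
    the variables one at a time. *)
Lemma farkas (R : realFieldType) (n : nat) (I : finType)
    (a : I -> 'I_n -> R) (b : I -> R) :
  (exists x : 'I_n -> R, forall i, \sum_k a i k * x k <= b i) \/
  (exists u : I -> R, [/\ forall i, 0 <= u i,
     forall k, \sum_i u i * a i k = 0 & \sum_i u i * b i < 0]).
Proof.
elim: n I a b => [|n IHn] I a b.
  have [/forallP b_ge0|] := boolP [forall i, 0 <= b i].
    by left; exists (fun=> 0) => i; rewrite big_ord0.
  rewrite negb_forall => /existsP[i]; rewrite -ltNge => bi_lt0; right.
  exists (fun l => (l == i)%:R); split=> [l|[]//|]; first exact: ler0n.
  by rewrite sum_pred1_mul.
pose p i := a i ord0.
(* The pair J = (i, j) yields a combination of the inequalities, with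
   coefficients [w J], in which the first variable cancels: an upper bound i
   combined with a lower bound j, or, on the diagonal, an inequality that does
   not involve that variable; all other pairs yield 0 <= 0. *)
pose w (J : I * I) l : R :=
  if (0 < p J.1) && (p J.2 < 0)
  then p J.1 * (l == J.2)%:R - p J.2 * (l == J.1)%:R
  else if (J.1 == J.2) && (p J.1 == 0) then (l == J.1)%:R else 0.
have w_ge0 J l : 0 <= w J l.
  rewrite /w; case: ifP => [/andP[p1 p2]|_]; last by case: ifP.
  by rewrite subr_ge0 (@le_trans _ _ 0) ?mulr_ge0 ?mulr_le0_ge0 ?ler0n //
    ltW.
have w_pair i j f : 0 < p i -> p j < 0 ->
    \sum_l w (i, j) l * f l = p i * f j - p j * f i.
  move=> pi pj; rewrite /w /= pi pj /= -(sum_pred1_mul j f).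
  rewrite -(sum_pred1_mul i f) !mulr_sumr -sumrB.
  by apply: eq_bigr => l _; rewrite mulrBl !mulrA.
have w_diag i f : p i = 0 -> \sum_l w (i, i) l * f l = f i.
  by move=> pi; rewrite /w /= pi ltxx eqxx /= eqxx sum_pred1_mul.
have w_elim J : \sum_l w J l * p l = 0.
  case: (boolP ((0 < p J.1) && (p J.2 < 0))) => [/andP[p1 p2]|np].
    by case: J p1 p2 => i j /= pi pj; rewrite w_pair // mulrC subrr.
  rewrite /w (negPf np).
  case: (boolP ((J.1 == J.2) && (p J.1 == 0))) => [/andP[_ /eqP pJ]|_].
    by rewrite sum_pred1_mul.
  by rewrite big1 // => l _; rewrite mul0r.
have [[x xP]|[u [u_ge0 ua ub]]] :=
  IHn _ (fun J k => \sum_l w J l * a l (lift ord0 k))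
        (fun J => \sum_l w J l * b l); last first.
  right; exists (fun l => \sum_J u J * w J l).
  have uwE f : \sum_l (\sum_J u J * w J l) * f l =
               \sum_J u J * \sum_l w J l * f l.
    under eq_bigr do rewrite mulr_suml.
    rewrite exchange_big /=; apply: eq_bigr => J _.
    by rewrite mulr_sumr; apply: eq_bigr => l _; rewrite mulrA.
  split=> [l|k|]; last by rewrite uwE.
    by apply: sumr_ge0 => J _; rewrite mulr_ge0.
  rewrite uwE; case: (unliftP ord0 k) => [k' ->|->]; first exact: ua.
  by rewrite big1 // => J _; rewrite w_elim mulr0.
(* A solution x of the eliminated system extends by any value z of the first
   variable between the lower bounds t i / p i with p i < 0 and the upper
   bounds t i / p i with p i > 0. *)
left; pose t i := b i - \sum_k a i (lift ord0 k) * x k.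
have t_ge0 J : 0 <= \sum_l w J l * t l.
  move: (xP J); rewrite -subr_ge0; congr (_ <= _).
  under [in RHS]eq_bigr do rewrite mulrBr.
  rewrite sumrB; congr (_ - _).
  under eq_bigr do rewrite mulr_suml.
  rewrite exchange_big /=; apply: eq_bigr => l _.
  by rewrite mulr_sumr; apply: eq_bigr => k _; rewrite mulrA.
have [j i pj pi|z [zlo zhi]] := @between_finite _ _
  (fun i => p i < 0) (fun i => 0 < p i)
  (fun i => t i / p i) (fun i => t i / p i).
  have := t_ge0 (i, j); rewrite w_pair // subr_ge0 => h.
  by rewrite ler_pdivlMr // mulrAC ler_ndivrMr // mulrC [_ * p i]mulrC.
exists (fun k => if unlift ord0 k is Some k' then x k' else z) => i.
rewrite big_ord_recl unlift_none; under eq_bigr do rewrite liftK.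
rewrite -lerBrDr -/(t i) -/(p i).
have [pi|pi|pi] := ltgtP (p i) 0.
- by rewrite mulrC -ler_ndivrMr // zlo.
- by rewrite mulrC -ler_pdivlMr // zhi.
by rewrite pi mul0r -(w_diag i t pi).
Qed.

(** * Duality of fractional matchings and fractional vertex covers *)

(** Nonnegative vertex values that add up to at least [r e] over the ends of
    each edge [e]: the feasible solutions of the dual of the fractional
    matching problem with weights [r]. *)
Definition fractional_vertex_cover (R : realType) (n m : nat)
    (G : graph 'I_n 'I_m) (r : 'cV[R]_m) (y : 'cV[R]_n) : Prop :=
  (forall i, 0 <= y i 0) /\
  forall e, r e 0 <= \sum_(i in ends G e) y i 0.

Lemma levP (R : realType) (k : nat) (u v : 'cV[R]_k) :
  reflect (forall i, u i 0 <= v i 0) (lev u v).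
Proof. exact: forallP. Qed.

Lemma incidence_mul (R : realType) (n m : nat) (G : graph 'I_n 'I_m)
    (x : 'cV[R]_m) i :
  (incidence R G *m x) i 0 = \sum_(e | i \in ends G e) x e 0.
Proof.
rewrite mxE [RHS]big_mkcond; apply: eq_bigr => e _.
by rewrite mxE mulr_natl mulrb.
Qed.

Lemma cover_weak_duality (R : realType) (n m : nat) (G : graph 'I_n 'I_m)
    (r x : 'cV[R]_m) (w y : 'cV[R]_n) :
  lev 0 x -> lev (incidence R G *m x) w -> fractional_vertex_cover G r y ->
  dot r x <= dot w y.
Proof.
move=> /levP x_ge0 /levP Ax_le [y_ge0 cov].
have {}x_ge0 e : 0 <= x e 0 by have := x_ge0 e; rewrite mxE.
apply: (@le_trans _ _ (\sum_e (\sum_(i in ends G e) y i 0) * x e 0)).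
  by apply: ler_sum => e _; apply: ler_wpM2r.
under eq_bigr do rewrite mulr_suml.
rewrite (exchange_big_dep xpredT) //=; apply: ler_sum => i _.
rewrite -mulr_sumr mulrC; apply: ler_wpM2r => //.
by rewrite -incidence_mul.
Qed.

(** The bound [v] is not assumed to be attained. *)
Lemma cover_strong_duality (R : realType) (n m : nat) (G : graph 'I_n 'I_m)
    (r : 'cV[R]_m) (v : R) :
  (forall x, fractional_matching G x -> dot r x <= v) ->
  exists2 y, fractional_vertex_cover G r y & dot (const_mx 1) y <= v.
Proof.
move=> ub_v.
(* The inequalities on y, in the form a y <= b: total value at most v,
   nonnegativity, and the covering condition of each edge. *)
pose a (l : 'I_1 + ('I_n + 'I_m)) (k : 'I_n) : R :=
  match l with
  | inl _ => 1
  | inr (inl i) => - (i == k)%:R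
  | inr (inr e) => - (k \in ends G e)%:R
  end.
pose b (l : 'I_1 + ('I_n + 'I_m)) : R :=
  match l with
  | inl _ => v
  | inr (inl i) => 0
  | inr (inr e) => - r e 0
  end.
have [[y yP]|[u [u_ge0 ua ub]]] := farkas a b.
  exists (\col_i y i); first split=> [i|e].
  - have := yP (inr (inl i)); rewrite /= mxE -oppr_le0.
    under eq_bigr do rewrite mulNr eq_sym.
    by rewrite sumrN sum_pred1_mul.
  - have := yP (inr (inr e)); rewrite /=.
    under eq_bigr do rewrite mulNr mulr_natl mulrb.
    rewrite sumrN lerN2 -big_mkcond /= => cov_e.
    by under [leRHS]eq_bigr do rewrite mxE.
  - have := yP (inl ord0); rewrite /=; apply: le_trans.
    by apply: ler_sum => i _; rewrite !mxE.
(* In an infeasibility certificate, the multipliers z of the covering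
   conditions satisfy A z <= t 1, with t the multiplier of the value bound, and
   have weight greater than t v.  If t > 0, then z / t is a fractional matching
   heavier than v; if t = 0, then z = 0. *)
exfalso; pose t := u (inl ord0); pose z e := u (inr (inr e)).
have z_ge0 e : 0 <= z e by exact: u_ge0.
have z_le k : \sum_(e | k \in ends G e) z e <= t.
  have := ua k; rewrite !big_sumType /= big_ord1 mulr1 -/t.
  under eq_bigr do rewrite mulrN mulrC.
  under [X in _ + (_ + X)]eq_bigr do rewrite mulrN mulr_natr mulrb.
  rewrite !sumrN sum_pred1_mul -big_mkcond /= => /eqP.
  rewrite -opprD subr_eq0 => /eqP ->.
  by rewrite lerDr u_ge0.
have : t * v < \sum_e r e 0 * z e.
  move: ub; rewrite !big_sumType /= big_ord1 -/t.
  rewrite [X in _ + (X + _)]big1; last by move=> i _; rewrite mulr0.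
  rewrite add0r; under eq_bigr do rewrite mulrN mulrC.
  by rewrite sumrN subr_lt0.
apply/negP; rewrite -leNgt.
have [t_gt0|] := ltP 0 t.
  rewrite -ler_pdivrMl // mulr_sumr.
  apply: (le_trans _ (ub_v (\col_e (t^-1 * z e)) _)); last first.
    split; apply/levP => i; rewrite ?incidence_mul !mxE.
      by rewrite mulr_ge0 // invr_ge0 ltW.
    under eq_bigr do rewrite mxE.
    by rewrite -mulr_sumr ler_pdivrMl // mulr1.
  by apply: ler_sum => e _; rewrite mxE mulrCA.
move=> t_le0; have z0 e : z e = 0.
  have /card_gt0P[k ke] : (0 < #|ends G e|)%N by rewrite card_ends.
  apply/eqP; rewrite eq_le z_ge0 andbT.
  rewrite (le_trans _ (le_trans (z_le k) t_le0)) //.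
  by rewrite (bigD1 e) //= lerDl sumr_ge0.
have -> : t = 0.
  by apply/eqP; rewrite eq_le t_le0 u_ge0.
by rewrite mul0r big1 // => e _; rewrite z0 mulr0.
Qed.

(** * Integral matchings *)

Lemma realvE (R : realType) (k : nat) (x : 'cV[bool]_k) i :
  realv R x i 0 = (x i 0)%:R.
Proof. by rewrite mxE. Qed.

Lemma lev0_realv (R : realType) (k : nat) (x : 'cV[bool]_k) :
  lev 0 (realv R x).
Proof. by apply/levP => i; rewrite realvE mxE ler0n. Qed.

Lemma dot_realv (R : realType) (k : nat) (c : 'cV[R]_k) (x : 'cV[bool]_k) :
  dot c (realv R x) = \sum_(i | x i 0) c i 0.
Proof.
rewrite /dot [RHS]big_mkcond; apply: eq_bigr => i _.
by rewrite realvE mulr_natr mulrb.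
Qed.

Lemma dotC (R : realType) (k : nat) (u v : 'cV[R]_k) : dot u v = dot v u.
Proof. by apply: eq_bigr => i _; rewrite mulrC. Qed.

Lemma realv_true (R : realType) (k : nat) :
  realv R (const_mx true : 'cV_k) = const_mx 1.
Proof. by apply/matrixP => i j; rewrite !mxE. Qed.

Lemma lev_incidence_realv (R : realType) (n m : nat) (G : graph 'I_n 'I_m)
    (x : 'cV[bool]_m) (w : 'cV[bool]_n) :
  lev (incidence R G *m realv R x) (realv R w) =
  [forall i, (#|[set e | x e 0%R & i \in ends G e]%SET| <= w i 0%R)%N].
Proof.
apply: eq_forallb => i; rewrite incidence_mul realvE.
under eq_bigr do rewrite realvE.
rewrite -[RHS](ler_nat R); congr (_ <= _).
rewrite -sum1_card natr_sum big_mkcond [RHS]big_mkcond /=.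
by apply: eq_bigr => e _; rewrite inE; case: (x e 0); case: (_ \in _).
Qed.

Lemma feasible_matching (R : realType) (n m : nat)
    (G : graph 'I_n 'I_m) (x : 'cV[bool]_m) :
  lev (incidence R G *m realv R x) (realv R (const_mx true)) =
  matching G [set e | x e 0]%SET.
Proof.
rewrite lev_incidence_realv; apply/forallP/forall_inP.
  move=> deg1 e; rewrite inE => xe; apply/forall_inP => f; rewrite inE => xf.
  apply/implyP => nef; rewrite -setI_eq0; apply/set0Pn => -[i].
  rewrite inE => /andP[ie if_]; case/eqP: nef.
  have := deg1 i; rewrite mxE => /card_le1_eqP; apply;
    by rewrite inE ?xe ?xf.
move=> mx i; rewrite mxE; apply/card_le1_eqP => e f.
rewrite !inE => /andP[xe ie] /andP[xf if_]; apply/eqP/negPn/negP => nef.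
move: (mx f); rewrite inE xf => /(_ isT)/forall_inP/(_ e).
rewrite inE xe => /(_ isT)/implyP/(_ nef)/pred0P/(_ i) /=.
by rewrite ie if_.
Qed.

Lemma matching_keep_edges (V E : finType) (G : graph V E) (P : pred E)
    (M : {set {e : E | P e}}) :
  matching (keep_edges G P) M = matching G (val @: M).
Proof.
apply/forall_inP/forall_inP => mM.
  move=> _ /imsetP[e eM ->]; apply/forall_inP => _ /imsetP[f fM ->].
  by rewrite (inj_eq val_inj); have /forall_inP := mM e eM; apply.
move=> e eM; apply/forall_inP => f fM.
have /forall_inP/(_ _ (imset_f val fM)) := mM _ (imset_f val eM).
by rewrite (inj_eq val_inj).
Qed.

(** * The ratio matching game and its core *)

(** Value of the edge set selected by [x] in the ratio objective. *)
Definition matching_ratio (R : realType) (m : nat) (c d : 'cV[R]_m) (d0 : R)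
    (x : 'cV[bool]_m) : R :=
  dot c (realv R x) / (d0 + dot d (realv R x)).

Lemma matching_ratio_le_game (R : realType) (n m : nat) (G : graph 'I_n 'I_m)
    (c d : 'cV[R]_m) (d0 : R) (w : 'cV[bool]_n) (x : 'cV[bool]_m) :
  lev (incidence R G *m realv R x) (realv R w) ->
  matching_ratio c d d0 x <= ratio_matching_game G c d d0 w.
Proof. by move=> xw; apply: le_bigmax_cond. Qed.

Lemma ratio_matching_game_ge0 (R : realType) (n m : nat) (G : graph 'I_n 'I_m)
    (c d : 'cV[R]_m) (d0 : R) (w : 'cV[bool]_n) :
  0 <= ratio_matching_game G c d d0 w.
Proof. exact: bigmax_ge_id. Qed.

Lemma edge_ratio_le_game (R : realType) (n m : nat) (G : graph 'I_n 'I_m)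
    (c d : 'cV[R]_m) (d0 : R) (w : 'cV[bool]_n) (e : 'I_m) :
  (forall i, i \in ends G e -> w i 0) ->
  edge_ratio c d d0 e 0 <= ratio_matching_game G c d d0 w.
Proof.
move=> ew; pose x : 'cV[bool]_m := \col_f (f == e).
have dotx (u : 'cV[R]_m) : dot u (realv R x) = u e 0.
  rewrite dot_realv; under eq_bigl do rewrite mxE.
  by rewrite big_pred1_eq.
have := @matching_ratio_le_game _ _ _ G c d d0 w x.
rewrite /matching_ratio !dotx mxE; apply.
apply/levP => i; rewrite incidence_mul realvE.
under eq_bigr do rewrite realvE mxE.
apply: (@le_trans _ _ (i \in ends G e)%:R); last first.
  by rewrite ler_nat; case: (boolP (i \in ends G e)) => // /ew ->.
rewrite -(sum_pred1_mul e (fun f => (i \in ends G f)%:R)) big_mkcond.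
by apply: ler_sum => f _; rewrite mulr_natr -mulrb.
Qed.

Section Game.
Variables (R : realType) (n m : nat) (G : graph 'I_n 'I_m).
Variables (c d : 'cV[R]_m) (d0 : R).
Hypothesis (c_gt0 : forall i, 0 < c i 0) (d_ge0 : forall i, 0 <= d i 0).
Hypothesis d0_gt0 : 0 < d0.

Let r := edge_ratio c d d0.
Let nu := ratio_matching_game G c d d0.
Let ratio := matching_ratio c d d0.
Let grand : 'cV[bool]_n := const_mx true.

Let denom_gt0 x : 0 < d0 + dot d (realv R x).
Proof. by rewrite ltr_wpDr // dot_realv sumr_ge0. Qed.

Lemma ratio_matching_game_attained w :
  exists2 x, lev (incidence R G *m realv R x) (realv R w) & nu w = ratio x.
Proof.
have [||x xw nuE] := @eq_bigmax _ _ _ 0 (const_mx false : 'cV[bool]_m)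
  (fun x => lev (incidence R G *m realv R x) (realv R w)) ratio.
- apply/levP => i; rewrite incidence_mul realvE big1 ?ler0n // => e _.
  by rewrite realvE mxE.
- move=> x _; rewrite /ratio /matching_ratio.
  rewrite divr_ge0 ?(ltW (denom_gt0 x)) // dot_realv sumr_ge0 //.
  by move=> e _; rewrite ltW.
by exists x; rewrite ?nuE.
Qed.

Lemma edge_term_le_ratio (x : 'cV[bool]_m) e :
  x e 0 -> c e 0 / (d0 + dot d (realv R x)) <= r e 0.
Proof.
move=> xe; rewrite mxE ler_pM2l // lef_pV2 ?posrE ?ltr_wpDr //.
  by rewrite lerD2l dot_realv (bigD1 e) //= lerDl sumr_ge0.
by rewrite dot_realv sumr_ge0.
Qed.

Lemma matching_ratio_le_dot (x : 'cV[bool]_m) : ratio x <= dot r (realv R x).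
Proof.
rewrite /ratio /matching_ratio [dot c _]dot_realv [dot r _]dot_realv mulr_suml.
by apply: ler_sum => e; apply: edge_term_le_ratio.
Qed.

Lemma core_fractional_vertex_cover y :
  core nu y <-> dot (const_mx 1) y = nu grand /\ fractional_vertex_cover G r y.
Proof.
split=> -[sum_y y_ge]; split=> //; last first.
  move=> a; have [x xa ->] := ratio_matching_game_attained a.
  apply: le_trans (matching_ratio_le_dot x) _.
  exact: cover_weak_duality (lev0_realv R x) xa y_ge.
split=> [i|e].
  have := y_ge (\col_k (k == i)); rewrite dotC dot_realv.
  under eq_bigl do rewrite mxE.
  by rewrite big_pred1_eq; apply: le_trans; apply: ratio_matching_game_ge0.
have := y_ge (\col_k (k \in ends G e)); rewrite dotC dot_realv.
under eq_bigl do rewrite mxE.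
by apply: le_trans; apply: edge_ratio_le_game => i ie; rewrite mxE.
Qed.

Lemma candidates_le_game :
  Num.max (max_edge_ratio c d d0) (max_matching_weight_reduced G c d d0) <=
  nu grand.
Proof.
rewrite ge_max; apply/andP; split.
  apply: bigmax_le => [|e _]; first exact: ratio_matching_game_ge0.
  by apply: edge_ratio_le_game => i _; rewrite mxE.
apply: bigmax_le => [|M]; first exact: ratio_matching_game_ge0.
rewrite matching_keep_edges => mM.
pose x : 'cV[bool]_m := \col_e (e \in val @: M).
have dotx (u : 'cV[R]_m) : dot u (realv R x) = \sum_(e in M) u (val e) 0.
  rewrite dot_realv; under eq_bigl do rewrite mxE.
  by rewrite big_imset //; apply: in2W val_inj.
have -> : \sum_(e in M) c (val e) 0 / d0 = ratio x.
  rewrite /ratio /matching_ratio !dotx -mulr_suml.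
  rewrite [X in d0 + X]big1 ?addr0 // => e _.
  by apply/eqP; rewrite eq_le d_ge0 andbT leNgt (valP e).
apply: matching_ratio_le_game; rewrite feasible_matching.
suff -> : [set e | x e 0]%SET = val @: M by [].
by apply/setP => e; rewrite inE mxE.
Qed.

(** If replacing every denominator d_0 + d(M) by d_0 + d_e does not increase
    the value of a matching M, then M is a single edge or d vanishes on M. *)
Lemma tight_ratio_le_candidates (x : 'cV[bool]_m) :
  lev (incidence R G *m realv R x) (realv R grand) ->
  dot r (realv R x) <= ratio x ->
  ratio x <=
  Num.max (max_edge_ratio c d d0) (max_matching_weight_reduced G c d d0).
Proof.
rewrite feasible_matching => mx tight.
pose D := dot d (realv R x).
(* The inequality between the two sums holds term by term, so equality of the
   sums forces equality of all terms. *)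
have dE e : x e 0 -> d e 0 = D.
  move=> xe.
  have sum0 : \sum_(f | x f 0) (r f 0 - c f 0 / (d0 + D)) = 0.
    apply/eqP; rewrite sumrB -mulr_suml -!dot_realv subr_eq0.
    by rewrite eq_le tight matching_ratio_le_dot.
  have gap_ge0 f : x f 0 -> 0 <= r f 0 - c f 0 / (d0 + D).
    by move=> xf; rewrite subr_ge0 edge_term_le_ratio.
  have /eqP := psumr_eq0P gap_ge0 sum0 xe; rewrite subr_eq0 mxE.
  have ce_neq0 : c e 0 != 0 by rewrite gt_eqF.
  rewrite (inj_eq (mulfI ce_neq0)) (inj_eq invr_inj).
  by rewrite (inj_eq (addrI _)) => /eqP.
(* Summing [dE] over the selected edges gives D = |M| D. *)
have [D0|D0] := eqVneq D 0; last first.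
  have /eqP/cards1P[e xE] : #|[set e | x e 0]%SET| = 1%N.
    have : D *+ #|[set e | x e 0]%SET| = D.
      rewrite -sumr_const {2}/D dot_realv; apply: eq_big => [e|e].
        by rewrite inE.
      by rewrite inE => /dE.
    rewrite -mulr_natr -[RHS]mulr1 => /(mulfI D0)/eqP.
    by rewrite pnatr_eq1 => /eqP.
  have dotx (u : 'cV[R]_m) : dot u (realv R x) = u e 0.
    rewrite dot_realv (eq_bigl (fun f => f == e)) ?big_pred1_eq // => f.
    by have /setP/(_ f) := xE; rewrite !inE.
  rewrite le_max; apply/orP; left; rewrite /ratio /matching_ratio !dotx.
  have := le_bigmax 0 (fun e => r e 0) e; rewrite mxE; exact.
rewrite le_max; apply/orP; right.
pose M := [set e : {e | ~~ (0 < d e 0)} | x (val e) 0]%SET.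
have valM : val @: M = [set e | x e 0]%SET.
  apply/setP => e; rewrite inE; apply/imsetP/idP => [[f]|xe].
    by rewrite inE => xf ->.
  have ne : ~~ (0 < d e 0) by rewrite dE // D0 ltxx.
  by exists (Sub e ne); rewrite ?inE SubK.
have -> : ratio x = \sum_(e in M) c (val e) 0 / d0.
  rewrite /ratio /matching_ratio -/D D0 addr0 -mulr_suml dot_realv.
  congr (_ / _).
  rewrite -(big_imset (h := val) (fun e => c e 0) (in2W val_inj)) /=.
  by apply: eq_bigl => e; rewrite valM inE.
apply: (@le_bigmax_cond _ _ _ 0 M _
  (fun M : {set _} => \sum_(e in M) c (val e) 0 / d0)).
by rewrite matching_keep_edges valM.
Qed.

End Game.

Local Open Scope classical_set_scope.

Theorem proposition7 (R : realType) (n m : nat) (G : graph 'I_n 'I_m)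
    (c d : 'cV[R]_m) (d0 : R)
    (hc : forall i, 0 < c i 0) (hd : forall i, 0 <= d i 0) (hd0 : 0 < d0) :
  core (ratio_matching_game G c d d0) !=set0 <->
  is_max (fractional_matching (R := R) G) (dot (edge_ratio c d d0))
    (Num.max (max_edge_ratio c d d0) (max_matching_weight_reduced G c d d0)).
Proof.
have le_game := candidates_le_game G c d0 hd.
have [x x1 nuE] := ratio_matching_game_attained G hc hd hd0 (const_mx true).
have x_le := matching_ratio_le_dot hc hd hd0 x.
split=> [[y /(core_fractional_vertex_cover G hc hd hd0)[sum_y cov_y]]|[_ ub]].
  have weak z : fractional_matching G z ->
      dot (edge_ratio c d d0) z <= ratio_matching_game G c d d0 (const_mx true).
    by case=> z0 z1; rewrite -sum_y; apply: cover_weak_duality z0 z1 cov_y.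
  have fx : fractional_matching G (realv R x).
    by split; [exact: lev0_realv | rewrite -realv_true].
  have x_ge := weak _ fx; rewrite nuE in x_ge.
  have -> : Num.max (max_edge_ratio c d d0)
      (max_matching_weight_reduced G c d d0) =
      ratio_matching_game G c d d0 (const_mx true).
    apply/eqP; rewrite eq_le le_game nuE.
    exact: tight_ratio_le_candidates.
  split=> //; exists (realv R x) => //.
  by apply/eqP; rewrite nuE eq_le x_le x_ge.
have [y cov_y y_le] := cover_strong_duality ub.
exists y; apply/(core_fractional_vertex_cover G hc hd hd0); split=> //.
apply/eqP; rewrite eq_le (le_trans y_le le_game) /= nuE (le_trans x_le) //.
apply: cover_weak_duality cov_y; first exact: lev0_realv.
by rewrite -realv_true.
Qed.
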